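(* Let $a_2<0$, $z>0$, and let $\mathsf{Q}$ be a probability measure on $\mathbb{R}^3$ with $\mathsf{Q}(\mathbb{S}^1_+\times(0,\infty))=1$. Assume that there exist vectors $u,v\in\mathbb{S}^1_+$, constants $0<a\le b<\infty$ and $\varepsilon>0$ such that $$\mathsf{Q}(U(u\pm\varepsilon)\times(a,b))>0,\qquad \mathsf{Q}(U(v\pm\varepsilon)\times(a,b))>0,\qquad U(u\pm\varepsilon)\cap U(v\pm\varepsilon)=\emptyset.$$ Let $H$ be the energy function of the facet process in $\mathbb{R}^2$ with coefficient $a_2$. Then for every bounded Borel set $\tilde\Lambda\subset\mathbb{R}^2$, $$Z_{\tilde\Lambda}=\int e^{-H(\gamma_{\tilde\Lambda})}\,\pi^z_{\tilde\Lambda}(\mathrm{d}\gamma)=+\infty,$$ and therefore the finite-volume Gibbs measures $\mathsf{P}_{\tilde\Lambda}(\mathrm{d}\gamma)=Z_{\tilde\Lambda}^{-1}e^{-H(\gamma_{\tilde\Lambda})}\pi^z_{\tilde\Lambda}(\mathrm{d}\gamma)$ do not exist (they are well defined only when $0<Z_{\tilde\Lambda}<\infty$).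
   Context: $\mathbb{S}^1_+=\{(u_1,u_2)\in\mathbb{S}^1:u_1>0\}\cup\{(0,1)\}$. For $u\in\mathbb{S}^1_+$ and $\varepsilon>0$, $U(u\pm\varepsilon)=\{w\in\mathbb{S}^1_+:|\sphericalangle(u,w)|\le\varepsilon\}$, where $\sphericalangle(u,w)$ is the angle between the vectors $u$ and $w$. Marks are $m=(n,R)\in\mathbb{S}^1_+\times(0,\infty)$; a configuration is a set of points $(x,n,R)\in\mathbb{R}^2\times\mathbb{S}^1_+\times(0,\infty)$ with pairwise distinct locations $x$ and finitely many locations in each bounded set. $\gamma_\Lambda$ is the restriction of $\gamma$ to points with location in $\Lambda$. The facet with normal vector $n$ and radius $R$ is $V(n,R)=\{v\in\mathbb{R}^2:\langle v,n\rangle=0,\ |v|\le R\}$ and $\mathcal{A}(\gamma)=\{x+V(n,R):(x,n,R)\in\gamma\}$. For finite $\gamma$, $$H(\gamma)=a_2\sum_{K_1\neq K_2\in\mathcal{A}(\gamma)}\mathbb{H}^0(K_1\cap K_2)\cdot\mathbf{1}[\mathbb{H}^0(K_1\cap K_2)<\infty],$$ where the sum is over pairs of distinct facets, $\mathbb{H}^0$ is the counting measure (0-dimensional Hausdorff measure), and terms with infinite $\mathbb{H}^0$ are $0$. $\pi^z_\Lambda$ is the distribution of the marked Poisson point process with intensity measure $z\lambda_\Lambda(\mathrm{d}x)\otimes\mathsf{Q}(\mathrm{d}m)$, where $\lambda_\Lambda$ is Lebesgue measure restricted to $\Lambda$.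
   Formalization: The bounded Borel set is additionally assumed to have positive Lebesgue measure; for a Lebesgue-null set the Poisson process is a.s. empty, so the partition function equals 1 and the Gibbs measure exists, and the claim as stated fails. *)

(* Defs.v *)
From HB Require Import structures.
From mathcomp Require Import all_boot all_order all_algebra.
From mathcomp Require Import all_classical all_reals all_analysis.
From mathcomp Require Import measurable_realfun.
Set Implicit Arguments.
Unset Strict Implicit.
Unset Printing Implicit Defensive.
Import Order.TTheory GRing.Theory Num.Theory numFieldNormedType.Exports.
Local Open Scope classical_set_scope.
Local Open Scope ring_scope.

(* The norm that the library puts on R * R is the sup norm; the Euclidean
   structure of the plane is therefore spelled out here.  The two norms have
   the same bounded sets, so [bounded_set] is used as is. *)
Definition dot {R : realType} (u w : R * R) : R := u.1 * w.1 + u.2 * w.2.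

Definition enorm {R : realType} (u : R * R) : R := Num.sqrt (dot u u).

Definition angle {R : realType} (u w : R * R) : R :=
  acos (dot u w / (enorm u * enorm w)).

Definition half_circle {R : realType} : set (R * R) :=
  [set u | enorm u = 1 /\ 0 < u.1] `|` [set (0, 1)].

Definition circle_nbhd {R : realType} (u : R * R) (eps : R) : set (R * R) :=
  [set w | half_circle w /\ `|angle u w| <= eps].

(* A mark ((n1, n2), r) is a point of R^3; a marked point is (x, mark). *)
Definition mark_space {R : realType} : set (R * R * R) :=
  half_circle `*` `]0, +oo[.

Record config (R : realType) := Config {
  points :> set (R * R * (R * R * R));
  config_marks : points `<=` setT `*` mark_space;
  config_simple : set_inj points fst;
  config_locally_finite : forall D : set (R * R), bounded_set D ->
    finite_set ((fst @` points) `&` D) }.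

Section config_instances.
Context {R : realType}.

Let set0_marks : (set0 : set (R * R * (R * R * R))) `<=` setT `*` mark_space.
Proof. exact: sub0set. Qed.

Let set0_simple : set_inj (set0 : set (R * R * (R * R * R))) fst.
Proof. by move=> x y; rewrite inE. Qed.

Let set0_locally_finite (D : set (R * R)) : bounded_set D ->
  finite_set (fst @` (set0 : set (R * R * (R * R * R))) `&` D).
Proof. by rewrite image_set0 set0I. Qed.

HB.instance Definition _ := gen_eqMixin (config R).
HB.instance Definition _ := gen_choiceMixin (config R).
HB.instance Definition _ := isPointed.Build (config R)
  (Config set0_marks set0_simple set0_locally_finite).

End config_instances.

Definition npoints {R : realType} (B : set (R * R * (R * R * R)))
  (g : config R) : \bar R := counting (points g `&` B).

Definition count_events {R : realType} : set (set (config R)) :=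
  [set E | exists (B : set (R * R * (R * R * R))) (C : set \bar R),
    [/\ measurable B, measurable C & E = npoints B @^-1` C]].

Definition config_space (R : realType) :=
  g_sigma_algebraType (@count_events R).

Definition independent d d' (T : measurableType d) (E : measurableType d')
    (R : realType) (P : probability T R) (n : nat) (X : 'I_n -> T -> E) :=
  forall C : 'I_n -> set E, (forall i, measurable (C i)) ->
  P (\bigcap_i (X i @^-1` C i)) = (\prod_(i < n) P (X i @^-1` C i))%E.

(* [P] is the law of a marked Poisson point process with intensity [mu].
   The second argument of [poisson_prob] is not used by the library. *)
Definition poisson_process_law {R : realType}
    (mu : set (R * R * (R * R * R)) -> \bar R)
    (P : probability (config_space R) R) : Prop :=
  [/\ forall B (k : nat), measurable B -> (mu B < +oo)%E ->
        P [set g | npoints B g = k%:R%:E] = poisson_prob (fine (mu B)) 0%N [set k],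
      forall B, measurable B -> mu B = +oo%E ->
        P [set g | npoints B g = +oo%E] = 1%E
    & forall (n : nat) (B : 'I_n -> set (R * R * (R * R * R))),
        (forall i, measurable (B i)) -> trivIset setT B ->
        independent P (fun i => npoints (B i))].

Section plane_lebesgue.
Context {R : realType}.

Definition lebesgue2 : set (R * R) -> \bar R :=
  (@lebesgue_measure R \x @lebesgue_measure R)%E.

Let lebesgue2_0 : lebesgue2 set0 = 0%E.
Proof.
exact: (measure0 (@lebesgue_measure R \x @lebesgue_measure R)%E).
Qed.

Let lebesgue2_ge0 (A : set (R * R)) : (0 <= lebesgue2 A)%E.
Proof.
exact: (measure_ge0 (@lebesgue_measure R \x @lebesgue_measure R)%E).
Qed.

Let lebesgue2_sigma_additive : semi_sigma_additive lebesgue2.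
Proof.
exact: (@measure_semi_sigma_additive _ _ _
  (@lebesgue_measure R \x @lebesgue_measure R)%E).
Qed.

HB.instance Definition _ := isMeasure.Build _ (R * R)%type R lebesgue2
  lebesgue2_0 lebesgue2_ge0 lebesgue2_sigma_additive.

End plane_lebesgue.

Definition intensity {R : realType} (z : R) (L : set (R * R))
    (mL : measurable L) (Q : probability (R * R * R)%type R) :
    set (R * R * (R * R * R)) -> \bar R :=
  fun B => (z%:E * (mrestr lebesgue2 mL \x Q) B)%E.

Definition restriction {R : realType} (L : set (R * R)) (g : config R) :
  set (R * R * (R * R * R)) := points g `&` (L `*` setT).

Definition facet {R : realType} (n : R * R) (r : R) : set (R * R) :=
  [set v | dot v n = 0 /\ enorm v <= r].

Definition facets {R : realType} (g : set (R * R * (R * R * R))) :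
    set (set (R * R)) :=
  [set [set p.1 + v | v in facet p.2.1 p.2.2] | p in g].

(* The sum runs over ordered pairs (K1, K2) of distinct facets.  It is only
   meaningful for finite [g]: a sum with infinite support is 0 by convention. *)
Definition energy {R : realType} (a2 : R) (g : set (R * R * (R * R * R))) : R :=
  a2 * \sum_(K \in [set K : set (R * R) * set (R * R) |
                     [/\ facets g K.1, facets g K.2 & K.1 <> K.2]])
         (fine (counting (K.1 `&` K.2) : \bar R)
          * ((counting (K.1 `&` K.2) : \bar R) < +oo)%E%:R).

Definition gibbs_weight {R : realType} (a2 : R) (L : set (R * R))
  (g : config_space R) : \bar R := (expR (- energy a2 (restriction L g)))%:E.

Definition partition_function {R : realType} (a2 : R) (L : set (R * R))
    (P : probability (config_space R) R) : \bar R :=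
  (\int[P]_g gibbs_weight a2 L g)%E.

(* [G] is the finite-volume Gibbs measure on [L] with reference law [P]; it is
   defined only if the partition function is positive and finite. *)
Definition is_gibbs_measure {R : realType} (a2 : R) (L : set (R * R))
    (P G : probability (config_space R) R) : Prop :=
  (0 < partition_function a2 L P < +oo)%E /\
  forall A : set (config_space R), measurable A ->
    G A = ((fine (partition_function a2 L P))^-1%:E
           * \int[P]_(g in A) gibbs_weight a2 L g)%E.

(* Main.v *)
Require Import Defs.
From HB Require Import structures.
From mathcomp Require Import all_boot all_order all_algebra.
From mathcomp Require Import all_classical all_reals all_analysis.
From mathcomp Require Import measurable_realfun.
From mathcomp Require Import ring lra.
Set Implicit Arguments.
Unset Strict Implicit.
Unset Printing Implicit Defensive.
Import Order.TTheory GRing.Theory Num.Theory numFieldNormedType.Exports.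
Local Open Scope classical_set_scope.
Local Open Scope ring_scope.

(** The interaction is attractive: every crossing of two facets lowers the
    energy by at least [- a2 > 0], and the number of crossings can be
    quadratic in the number of points, which no Poisson weight can compensate.

    By [crossing_classes] there are two disjoint classes [A1] and [A2] of marks,
    both of positive [Q]-measure, such that a facet with mark in [A1] and a
    facet with mark in [A2] meet in exactly one point as soon as their centers
    are [rho]-close.  This uses that directions from the two given arcs are
    never parallel; the arcs themselves may come arbitrarily close to opposite
    directions, so one first shrinks to neighborhoods of two support points of
    [Q] ([exists_support_point], [separate_directions]).  In the same way [L]
    contains a piece [D] of positive area and of diameter at most [rho]
    ([small_positive_piece]).

    Let [N1] and [N2] count the points in [D * A1] and [D * A2].  They are
    independent Poisson variables with positive parameters.  On the event
    [N1 = N2 = k] each of the [k ^ 2] pairs crosses, so that the weight is at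
    least [expR (- a2 * k ^ 2)] ([energy_le]), whereas the event has probability
    a constant times [(lam1 * lam2) ^ k / k! ^ 2] ([poisson_two_counts]).  The
    product of the two is unbounded in [k] ([gaussian_beats_factorial]), and it
    is a lower bound of the partition function for every [k]
    ([cst_le_integral]). *)

(** * Integrals of functions that need not be measurable *)

(** The integral of a nonnegative function is a supremum over the simple
    functions below it, so monotonicity holds without measurability.  This is
    what allows the Gibbs weight to be bounded below without showing that the
    energy is measurable. *)
Lemma le_integral_pos d (T : measurableType d) (R : realType)
    (mu : {measure set T -> \bar R}) (D : set T) (f g : T -> \bar R) :
  (forall x, D x -> 0 <= f x)%E -> (forall x, 0 <= g x)%E ->
  (forall x, D x -> f x <= g x)%E ->
  (\int[mu]_(x in D) f x <= \int[mu]_x g x)%E.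
Proof.
move=> f0 g0 fg; rewrite !ge0_integralE//.
apply: ereal_sup_le => _ [h /= hf <-]; exists h => //= x.
rewrite patch_setT; apply: le_trans (hf x) _.
by rewrite patchE; case: ifPn => // /[!inE]; exact: fg.
Qed.

Lemma cst_le_integral d (T : measurableType d) (R : realType)
    (mu : {measure set T -> \bar R}) (A : set T) (c : R) (f : T -> \bar R) :
  measurable A -> 0 <= c -> (forall x, 0 <= f x)%E ->
  (forall x, A x -> c%:E <= f x)%E -> (c%:E * mu A <= \int[mu]_x f x)%E.
Proof.
by move=> mA c0 f0 cf; rewrite -integral_cst//; apply: le_integral_pos.
Qed.

(** * Facets in the plane *)

Definition det2 {R : realType} (u w : R * R) : R := u.1 * w.2 - u.2 * w.1.

Lemma enorm_le (R : realType) (u : R * R) (r : R) : 0 <= r ->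
  (enorm u <= r) = (dot u u <= r ^+ 2).
Proof.
move=> r0; rewrite /enorm -{1}[r]ger0_norm// -sqrtr_sqr ler_sqrt//.
exact: sqr_ge0.
Qed.

Lemma half_circle_unit (R : realType) (n : R * R) :
  half_circle n -> dot n n = 1.
Proof.
case=> [[]|->]; last by rewrite /dot/= mul0r mulr1 add0r.
rewrite /enorm => n1 _; rewrite -[LHS]sqr_sqrtr ?n1 ?expr1n//.
by rewrite addr_ge0// -expr2 sqr_ge0.
Qed.

Lemma dot_ge0 (R : realType) (u : R * R) : 0 <= dot u u.
Proof. by rewrite addr_ge0// -expr2 sqr_ge0. Qed.

Lemma dot_eq0 (R : realType) (u : R * R) : dot u u = 0 -> u = 0.
Proof.
case: u => u1 u2; rewrite /dot/= -!expr2 => /eqP.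
by rewrite paddr_eq0 ?sqr_ge0// !sqrf_eq0 => /andP[/eqP-> /eqP->].
Qed.

(** [facets g] is the image of [g] under this map; it is named so that one can
    say that distinct points of a configuration carry distinct facets. *)
Definition placed_facet {R : realType} (p : R * R * (R * R * R)) : set (R * R) :=
  [set p.1 + v | v in facet p.2.1 p.2.2].

Lemma placed_facetE (R : realType) (x n : R * R) (r : R) (y : R * R) : 0 <= r ->
  placed_facet (x, (n, r)) y <->
  dot (y - x) n = 0 /\ dot (y - x) (y - x) <= r ^+ 2.
Proof.
move=> r0; rewrite /placed_facet /facet /=; split.
  by move=> [v [vn]]; rewrite enorm_le// => vr <-; rewrite addrC addKr.
move=> [yn yr]; exists (y - x); last by rewrite addrC subrK.
by rewrite enorm_le.
Qed.

Lemma placed_facet_line (R : realType) (x n : R * R) (r s : R) :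
  dot n n = 1 -> 0 <= r -> s ^+ 2 <= r ^+ 2 ->
  placed_facet (x, (n, r)) (x.1 - s * n.2, x.2 + s * n.1).
Proof.
move=> n1 r0 sr; apply/placed_facetE => //; split.
  by rewrite /dot /=; ring.
apply: le_trans sr; rewrite -[leRHS]mulr1 -n1 le_eqVlt; apply/orP; left.
by apply/eqP; rewrite /dot /=; ring.
Qed.

(** The two ends [x +- r k] of the inner facet, [k] being [n] turned by a right
    angle, lie within [r'] of the other center; the parallelogram law
    averages the two inequalities. *)
Lemma placed_facet_radius (R : realType) (x x' n n' : R * R) (r r' : R) :
  dot n n = 1 -> 0 <= r -> 0 <= r' ->
  placed_facet (x, (n, r)) `<=` placed_facet (x', (n', r')) ->
  dot (x - x') (x - x') + r ^+ 2 <= r' ^+ 2.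
Proof.
move=> n1 r0 r'0 sub.
have end_point s := @placed_facet_line _ x n r s n1 r0.
have [_ h1] := iffLR (placed_facetE _ _ _ r'0) (sub _ (end_point r (lexx _))).
have Nr : (- r) ^+ 2 <= r ^+ 2 by rewrite sqrrN.
have [_ h2] := iffLR (placed_facetE _ _ _ r'0) (sub _ (end_point (- r) Nr)).
have e : dot (x - x') (x - x') + r ^+ 2 * dot n n <= r' ^+ 2.
  by move: h1 h2; rewrite /dot /=; nra.
by move: e; rewrite n1 mulr1.
Qed.

(** Applying [placed_facet_radius] in both directions makes the radii equal and
    the distance of the centers zero. *)
Lemma placed_facet_center (R : realType) (x x' n n' : R * R) (r r' : R) :
  dot n n = 1 -> dot n' n' = 1 -> 0 <= r -> 0 <= r' ->
  placed_facet (x, (n, r)) = placed_facet (x', (n', r')) -> x = x'.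
Proof.
move=> n1 n1' r0 r0' e; apply/subr0_eq/dot_eq0/eqP.
have h : dot (x - x') (x - x') + r ^+ 2 <= r' ^+ 2.
  by apply: (placed_facet_radius n1 r0 r0' (n' := n')); rewrite e.
have h' : dot (x' - x) (x' - x) + r' ^+ 2 <= r ^+ 2.
  by apply: (placed_facet_radius n1' r0' r0 (n' := n)); rewrite e.
rewrite eq_le dot_ge0 andbT.
by have := dot_ge0 (x' - x); lra.
Qed.

Lemma dot_CauchySchwarz (R : realType) (u w : R * R) :
  dot u w ^+ 2 <= dot u u * dot w w.
Proof.
have -> : dot u u * dot w w = dot u w ^+ 2 + det2 u w ^+ 2.
  by rewrite /dot /det2; ring.
by rewrite lerDl sqr_ge0.
Qed.

(** The lines carrying the two facets meet in one point since their normals are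
    not parallel.  By Cramer's rule that point is at distance
    [|<y - x, n>| / |det2 m n|] from [x] along the first line, and likewise on
    the second; both distances are at most [a] once the centers are
    [a * d]-close, so that the point belongs to the two facets. *)
Lemma placed_facet_cross (R : realType) (x y m n : R * R) (r s a d : R) :
  dot m m = 1 -> dot n n = 1 -> 0 <= a -> a <= r -> a <= s -> 0 < d ->
  d <= `|det2 m n| -> dot (y - x) (y - x) <= (a * d) ^+ 2 ->
  exists c, placed_facet (x, (m, r)) `&` placed_facet (y, (n, s)) = [set c].
Proof.
move=> m1 n1 a0 ar as' d0 dmn xy.
have D0 : det2 m n != 0 by rewrite -normr_gt0 (lt_le_trans d0).
have r0 := le_trans a0 ar; have s0 := le_trans a0 as'.
have bound (k : R * R) (t : R) : dot k k = 1 -> a <= t ->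
    (dot (y - x) k / det2 m n) ^+ 2 <= t ^+ 2.
  move=> k1 at'; apply: (@le_trans _ _ (a ^+ 2)); last first.
    by rewrite ler_pXn2r// nnegrE (le_trans a0).
  rewrite expr_div_n ler_pdivrMr ?exprn_even_gt0//.
  apply: le_trans (dot_CauchySchwarz _ _) _; rewrite k1 mulr1.
  apply: le_trans xy _; rewrite exprMn ler_wpM2l ?sqr_ge0//.
  by rewrite -[leRHS]real_normK ?num_real// ler_pXn2r// nnegrE ltW.
set t := dot (y - x) n / det2 m n; set s' := dot (y - x) m / det2 m n.
pose c : R * R := (x.1 - t * m.2, x.2 + t * m.1).
have cE : c = (y.1 - s' * n.2, y.2 + s' * n.1).
  rewrite /c /t /s'; move: D0; rewrite /det2 /dot /= => D0.
  by congr pair; field.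
have t2 : t ^+ 2 <= r ^+ 2 by exact: bound.
have s2 : s' ^+ 2 <= s ^+ 2 by exact: bound.
exists c; apply/seteqP; split; last first.
  move=> _ ->; split; first exact: placed_facet_line.
  by rewrite cE; exact: placed_facet_line.
move=> p /= [/(placed_facetE _ _ _ r0)[pm _] /(placed_facetE _ _ _ s0)[pn _]].
(* a point on both lines has the coordinates of c, again by Cramer's rule *)
have E1 : det2 m n * p.1 = det2 m n * c.1.
  have -> : det2 m n * p.1 = dot (p - x) m * n.2 - dot (p - y) n * m.2
     - dot (y - x) n * m.2 + det2 m n * x.1 by rewrite /dot /det2 /=; ring.
  by rewrite pm pn /c /t /=; move: D0; rewrite /det2 => D0; field.
have E2 : det2 m n * p.2 = det2 m n * c.2.
  have -> : det2 m n * p.2 = - dot (p - x) m * n.1 + dot (p - y) n * m.1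
     + dot (y - x) n * m.1 + det2 m n * x.2 by rewrite /dot /det2 /=; ring.
  by rewrite pm pn /c /t /=; move: D0; rewrite /det2 => D0; field.
move: E1 E2 => /(mulfI D0) e1 /(mulfI D0) e2.
by rewrite (surjective_pairing p) e1 e2.
Qed.

(** * Localization of positive measure *)

Definition box {R : realType} (x : R * R) (e : R) : set (R * R) :=
  `]x.1 - e, x.1 + e[ `*` `]x.2 - e, x.2 + e[.

Lemma measurable_box (R : realType) (x : R * R) (e : R) : measurable (box x e).
Proof. exact: measurableX. Qed.

(** Remove from [S] the preimages of the rational rectangles in which [S] has
    measure zero.  There are countably many of them, so that some point of [S]
    remains, and each box around its image contains a rational rectangle around
    it. *)
Lemma exists_support_point d (T : measurableType d) (R : realType)
    (mu : {measure set T -> \bar R}) (f : T -> R * R) (S : set T) :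
  measurable_fun setT f -> measurable S -> (0 < mu S)%E ->
  exists2 t, S t & forall e, 0 < e -> (0 < mu (S `&` f @^-1` box (f t) e))%E.
Proof.
move=> mf mS S0.
pose cell (c : (rat * rat) * (rat * rat)) : set T := S `&` f @^-1`
  (`](ratr c.1.1 : R), ratr c.1.2[ `*` `](ratr c.2.1 : R), ratr c.2.2[).
have mpre (B : set (R * R)) : measurable B -> measurable (S `&` f @^-1` B).
  by move=> mB; apply: measurableI => //; rewrite -[_ @^-1` _]setTI; exact: mf.
have mcell c : measurable (cell c) by apply: mpre; exact: measurableX.
pose F (i : nat) : set T :=
  if unpickle i is Some c then if mu (cell c) == 0%E then cell c else set0
  else set0.
have negF : mu.-negligible (\bigcup_i F i).
  apply: negligible_bigcup => i; rewrite /F; case: unpickle => [c|]; last first.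
    exact: negligible_set0.
  case: ifPn => [/eqP c0|_]; last exact: negligible_set0.
  by exists (cell c); split.
have [t St tF] : exists2 t, S t & ~ (\bigcup_i F i) t.
  apply: contrapT => noT; have : mu.-negligible S.
    apply: negligibleS negF => t St; apply: contrapT => tF.
    by apply: noT; exists t.
  by move=> /(measure_negligible mS) S00; rewrite S00 ltxx in S0.
exists t => // e e0.
have [q1 /[!in_itv]/= /andP[q1l q1r]] : exists q, ratr q \in `](f t).1 - e, (f t).1[.
  by apply: rat_in_itvoo; lra.
have [q1' /[!in_itv]/= /andP[q1l' q1r']] : exists q, ratr q \in `](f t).1, (f t).1 + e[.
  by apply: rat_in_itvoo; lra.
have [q2 /[!in_itv]/= /andP[q2l q2r]] : exists q, ratr q \in `](f t).2 - e, (f t).2[.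
  by apply: rat_in_itvoo; lra.
have [q2' /[!in_itv]/= /andP[q2l' q2r']] : exists q, ratr q \in `](f t).2, (f t).2 + e[.
  by apply: rat_in_itvoo; lra.
pose c := ((q1, q1'), (q2, q2')).
have ct : cell c t.
  by split => //=; rewrite /= !in_itv /= q1r q1l' q2r q2l'.
have c0 : (0 < mu (cell c))%E.
  rewrite lt_neqAle measure_ge0 andbT eq_sym; apply/negP => c0.
  have [i iE] : exists i, unpickle i = Some c.
    by exists (pickle c); rewrite pickleK.
  by apply: tF; exists i; rewrite // /F iE c0.
apply: (lt_le_trans c0); apply: le_measure; rewrite ?inE//.
  by apply: mpre; exact: measurable_box.
apply: setIS => s /=; rewrite /box/= !in_itv/=.
by move=> [/andP[? ?] /andP[? ?]]; split; apply/andP; split; lra.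
Qed.

Lemma box_norm (R : realType) (x y : R * R) (e : R) : box x e y ->
  `|y.1 - x.1| < e /\ `|y.2 - x.2| < e.
Proof.
rewrite /box /= !in_itv /= => -[/andP[? ?] /andP[? ?]].
by rewrite !ltr_norml; split; apply/andP; split; lra.
Qed.

(** The determinant is bilinear and unit vectors have coordinates of absolute
    value at most 1, so each of the four coordinate changes costs at most
    [e]. *)
Lemma det2_lipschitz (R : realType) (m n m' n' : R * R) (e : R) :
  dot n n = 1 -> dot m' m' = 1 -> box m' e m -> box n' e n ->
  `|det2 m' n'| <= `|det2 m n| + 4 * e.
Proof.
have coord (k : R * R) : dot k k = 1 -> `|k.1| <= 1 /\ `|k.2| <= 1.
  rewrite /dot -!expr2 => k1.
  by split; rewrite -(@expr_le1 _ 2)// real_normK ?num_real//;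
    [have := sqr_ge0 k.2|have := sqr_ge0 k.1]; lra.
move=> /coord[n1 n2] /coord[m1 m2] /box_norm[e1 e2] /box_norm[e3 e4].
have -> : det2 m' n' = det2 m n + (- ((m.1 - m'.1) * n.2) + (m.2 - m'.2) * n.1
    + (- (m'.1 * (n.2 - n'.2)) + m'.2 * (n.1 - n'.1))).
  by rewrite /det2; ring.
have e0 : 0 <= e by apply: le_trans (ltW e1).
have le_prod (p q : R) : `|p| < e -> `|q| <= 1 -> `|p * q| <= e.
  by move=> pe q1; rewrite normrM -[e]mulr1 ler_pM// ltW.
apply: (le_trans (ler_normD _ _)); rewrite lerD2l.
apply: (le_trans (ler_normD _ _)).
have -> : 4 * e = (e + e) + (e + e) by ring.
by apply: lerD; (apply: (le_trans (ler_normD _ _)); apply: lerD);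
  rewrite ?normrN; first [exact: le_prod | rewrite mulrC; exact: le_prod].
Qed.

(** Determinants that do not vanish can still come arbitrarily close to zero, as
    for directions close to [(0, 1)] and to [(0, -1)].  Restricting to small neighborhoods of
    two support points provides a uniform lower bound. *)
Lemma separate_directions d (T : measurableType d) (R : realType)
    (mu : {measure set T -> \bar R}) (f : T -> R * R) (S1 S2 : set T) :
  measurable_fun setT f -> measurable S1 -> measurable S2 ->
  (forall s, S1 s -> dot (f s) (f s) = 1) ->
  (forall s, S2 s -> dot (f s) (f s) = 1) ->
  (forall s t, S1 s -> S2 t -> det2 (f s) (f t) != 0) ->
  (0 < mu S1)%E -> (0 < mu S2)%E ->
  exists (A1 A2 : set T) (delta : R),
    [/\ measurable A1, measurable A2, A1 `<=` S1 & A2 `<=` S2] /\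
    [/\ (0 < mu A1)%E, (0 < mu A2)%E, 0 < delta &
      forall s t, A1 s -> A2 t -> delta <= `|det2 (f s) (f t)|].
Proof.
move=> mf mS1 mS2 u1 u2 S12 S1_gt0 S2_gt0.
have [s0 Ss0 supp1] := exists_support_point mf mS1 S1_gt0.
have [t0 St0 supp2] := exists_support_point mf mS2 S2_gt0.
pose D := `|det2 (f s0) (f t0)|.
have D0 : 0 < D by rewrite normr_gt0 S12.
(* by the Lipschitz bound, boxes of size D / 8 lose at most half of D *)
have e0 : 0 < D / 8 by rewrite divr_gt0.
have mpre (S : set T) x : measurable S -> measurable (S `&` f @^-1` box x (D / 8)).
  move=> mS; apply: measurableI => //; rewrite -[_ @^-1` _]setTI.
  by apply: mf => //; exact: measurable_box.
exists (S1 `&` f @^-1` box (f s0) (D / 8)), (S2 `&` f @^-1` box (f t0) (D / 8)), (D / 2).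
split; first by split=> //; exact: mpre.
split; [exact: supp1|exact: supp2|by rewrite divr_gt0|].
move=> s t [S1s bs] [S2t bt].
have := det2_lipschitz (u2 _ S2t) (u1 _ Ss0) bs bt.
by rewrite -/D; lra.
Qed.

Lemma small_positive_piece (R : realType) (L : set (R * R)) (r : R) :
  measurable L -> (0 < lebesgue2 L)%E -> 0 < r ->
  exists D : set (R * R), [/\ measurable D, D `<=` L, (0 < lebesgue2 D)%E &
    forall x y, D x -> D y -> dot (y - x) (y - x) <= r ^+ 2].
Proof.
move=> mL L0 r0.
have [x0 Lx0 supp] := exists_support_point (@measurable_id _ _ setT) mL L0.
(* coordinates in a box of half-side r / 4 differ by at most r / 2 *)
have e0 : 0 < r / 4 by rewrite divr_gt0.
exists (L `&` box x0 (r / 4)); split => //.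
- by apply: measurableI => //; exact: measurable_box.
- exact: supp.
move=> x y [_ /box_norm[x1 x2]] [_ /box_norm[y1 y2]].
have sq (p q c : R) : `|p - c| < r / 4 -> `|q - c| < r / 4 ->
    (p - q) * (p - q) <= r ^+ 2 / 4.
  move=> pc qc; have pq : `|p - q| <= r / 2.
    rewrite (_ : p - q = (p - c) - (q - c)); last by ring.
    by apply: (le_trans (ler_normB _ _)); lra.
  rewrite -expr2 -real_normK ?num_real// (_ : _ / 4 = (r / 2) ^+ 2); last by field.
  by rewrite ler_pXn2r// nnegrE// divr_ge0// ltW.
have := sq _ _ _ y1 x1; have := sq _ _ _ y2 x2.
by rewrite /dot /=; have := sqr_ge0 r; lra.
Qed.

(** * The arcs of normal directions *)

Lemma measurable_dot (R : realType) (u : R * R) : measurable_fun setT (dot u).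
Proof.
by apply: measurable_funD; apply: measurable_funM.
Qed.

Lemma half_circleE (R : realType) : @half_circle R =
  [set u | dot u u = 1] `&` ([set u | 0 < u.1] `|` [set (0, 1)]).
Proof.
apply/seteqP; split=> u.
  move=> hu; split; first exact: half_circle_unit.
  by case: hu => [[]|]; [left|right].
move=> [u1 [u0|->]]; last by right.
by left; split=> //; rewrite /enorm u1 sqrtr1.
Qed.

Lemma measurable_half_circle (R : realType) : measurable (@half_circle R).
Proof.
have m1 : measurable_fun setT (fst : R * R -> R) by exact: measurable_fst.
have m2 : measurable_fun setT (snd : R * R -> R) by exact: measurable_snd.
rewrite half_circleE; apply: measurableI.
  rewrite (_ : mkset _ = (fun u : R * R => u.1 * u.1 + u.2 * u.2) @^-1` [set 1])//.
  rewrite -[_ @^-1` _]setTI.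
  suff : measurable_fun setT (fun u : R * R => u.1 * u.1 + u.2 * u.2) by apply.
  by apply: measurable_funD; exact: measurable_funM.
apply: measurableU; last first.
  rewrite (_ : [set _] = [set 0] `*` [set 1]); first exact: measurableX.
  by apply/seteqP; split=> [_ ->//|[a b] /= [-> ->]].
rewrite (_ : mkset _ = fst @^-1` `]0, +oo[); last first.
  by apply/seteqP; split=> u; rewrite /= in_itv /= andbT.
by rewrite -[_ @^-1` _]setTI; exact: m1.
Qed.

Lemma acos_le (R : realType) (t e : R) : -1 <= t <= 1 -> 0 <= e <= pi ->
  (acos t <= e) = (cos e <= t).
Proof.
move=> t1 e0.
have at0 : acos t \in `[0, pi] by rewrite in_itv /= acos_ge0// acos_lepi.
rewrite -{2}(@acosK _ t) ?in_itv//= !leNgt; congr negb.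
by rewrite ltr_cos// in_itv.
Qed.

(** On the half circle the angle condition says that [dot u w] is at least
    [cos e], or is void when [e] exceeds [pi]. *)
Lemma measurable_circle_nbhd (R : realType) (u : R * R) (e : R) :
  half_circle u -> 0 < e -> measurable (circle_nbhd u e).
Proof.
move=> hu e0; have u1 := half_circle_unit hu.
have angleE w : half_circle w ->
    angle u w = acos (dot u w) /\ -1 <= dot u w <= 1.
  move=> /half_circle_unit w1; split.
    by rewrite /angle /enorm u1 w1 sqrtr1 mulr1 divr1.
  rewrite -ler_norml -(@expr_le1 _ 2)// real_normK ?num_real//.
  by apply: le_trans (dot_CauchySchwarz _ _) _; rewrite u1 w1 mulr1.
have [pie|epi] := ltP pi e.
  rewrite (_ : circle_nbhd _ _ = half_circle); first exact: measurable_half_circle.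
  apply/seteqP; split=> [w []//|w hw]; split => //.
  have [-> uw] := angleE _ hw.
  by rewrite ger0_norm ?acos_ge0// (le_trans (acos_lepi uw))// ltW.
rewrite (_ : circle_nbhd _ _ = half_circle `&` dot u @^-1` `[cos e, +oo[).
  apply: measurableI; first exact: measurable_half_circle.
  by rewrite -[_ @^-1` _]setTI; exact: measurable_dot.
have halfE w : half_circle w -> `|angle u w| <= e = (cos e <= dot u w).
  move=> hw; have [-> uw] := angleE _ hw.
  by rewrite ger0_norm ?acos_ge0// acos_le// epi ltW.
by apply/seteqP; split=> w /= [hw]; rewrite /circle_nbhd /= in_itv /= andbT halfE.
Qed.

(** Unit vectors with zero determinant are equal or opposite, and the half
    circle contains one vector of each opposite pair. *)
Lemma half_circle_det2_neq0 (R : realType) (m n : R * R) :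
  half_circle m -> half_circle n -> m <> n -> det2 m n != 0.
Proof.
move=> hm hn mn; apply/eqP => D0; apply: mn.
have [m1 n1] := (half_circle_unit hm, half_circle_unit hn).
have c2 : dot m n ^+ 2 = 1.
  rewrite -[RHS]mulr1 -{1}m1 -n1.
  have -> : dot m m * dot n n = dot m n ^+ 2 + det2 m n ^+ 2.
    by rewrite /dot /det2; ring.
  by rewrite D0 expr0n addr0.
have mE : m = (dot m n * n.1, dot m n * n.2).
  move: D0 n1; rewrite /dot /det2 => D0 n1.
  rewrite [LHS]surjective_pairing; congr pair.
    rewrite -[LHS]mulr1 -n1; apply/eqP; rewrite -subr_eq0; apply/eqP.
    by rewrite -[RHS](mulr0 n.2) -D0; ring.
  rewrite -[LHS]mulr1 -n1; apply/eqP; rewrite -subr_eq0; apply/eqP.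
  by rewrite -[RHS](mulr0 (- n.1)) -D0; ring.
move/eqP : c2; rewrite sqrf_eq1 => /orP[/eqP c1|/eqP c1].
  by rewrite mE c1 !mul1r -surjective_pairing.
exfalso; rewrite c1 !mulN1r in mE.
move: hm hn; rewrite mE => -[[_ /= h1]|[/eqP h1 h2]] [[_ h3]|h3].
- lra.
- by rewrite h3 /= oppr0 ltxx in h1.
- by rewrite oppr_eq0 gt_eqF in h1.
- by rewrite h3 /= in h2; lra.
Qed.

(** * Two classes of crossing facets *)

(** The two arcs contain no parallel directions, so that separation provides
    classes whose determinants are at least [delta]; as all radii exceed [a],
    [rho] can be taken to be [a * delta]. *)
Lemma crossing_classes (R : realType) (Q : probability (R * R * R)%type R)
    (u v : R * R) (a b eps : R) :
  half_circle u -> half_circle v -> 0 < a -> 0 < eps ->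
  (0 < Q (circle_nbhd u eps `*` `]a, b[))%E ->
  (0 < Q (circle_nbhd v eps `*` `]a, b[))%E ->
  circle_nbhd u eps `&` circle_nbhd v eps = set0 ->
  exists (A1 A2 : set (R * R * R)) (rho : R),
    [/\ measurable A1, measurable A2, (0 < Q A1)%E & (0 < Q A2)%E] /\
    [/\ 0 < rho, A1 `&` A2 = set0 & forall x y m1 m2,
      A1 m1 -> A2 m2 -> dot (y - x) (y - x) <= rho ^+ 2 ->
      exists c, placed_facet (x, m1) `&` placed_facet (y, m2) = [set c]].
Proof.
move=> hu hv a0 e0 Qu Qv uv.
have mS w : half_circle w -> measurable (circle_nbhd w eps `*` `]a, b[ : set (R * R * R)).
  by move=> hw; apply: measurableX => //; exact: measurable_circle_nbhd.
have unit w m : (circle_nbhd w eps `*` `]a, b[) m -> dot m.1 m.1 = 1.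
  by move=> [[/half_circle_unit]].
have nonparallel m n : (circle_nbhd u eps `*` `]a, b[) m ->
    (circle_nbhd v eps `*` `]a, b[) n -> det2 m.1 n.1 != 0.
  move=> [um _] [vn _]; apply: half_circle_det2_neq0; [by case: um|by case: vn|].
  move=> mn; have : (circle_nbhd u eps `&` circle_nbhd v eps) m.1.
    by split => //; rewrite mn.
  by rewrite uv.
have [A1 [A2 [delta [[mA1 mA2 A1S A2S] [A1_gt0 A2_gt0 d0 sep]]]]] :=
  separate_directions measurable_fst (mS _ hu) (mS _ hv)
    (unit u) (unit v) nonparallel Qu Qv.
exists A1, A2, (a * delta); split=> //; split; first exact: mulr_gt0.
  apply/seteqP; split => // m [A1m A2m].
  have := sep _ _ A1m A2m; rewrite /det2 mulrC subrr normr0.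
  by rewrite leNgt d0.
move=> x y [m1 r1] [m2 r2] A1m A2m xy.
have [_ /=] := A1S _ A1m; rewrite in_itv /= => /andP[ar1 _].
have [_ /=] := A2S _ A2m; rewrite in_itv /= => /andP[ar2 _].
exact: (placed_facet_cross (unit _ _ (A1S _ A1m)) (unit _ _ (A2S _ A2m))
  (ltW a0) (ltW ar1) (ltW ar2) d0 (sep _ _ A1m A2m) xy).
Qed.

(** * The energy of two crossing families *)

Lemma ler_fsum_subset (T : choiceType) (R : realType) (A B : set T) (f : T -> R) :
  finite_set B -> A `<=` B -> (forall t, B t -> 0 <= f t) ->
  \sum_(t \in A) f t <= \sum_(t \in B) f t.
Proof.
move=> fB AB f0; have fA := sub_finite_set AB fB.
rewrite -lee_fin -!fsumEFin//; apply: lee_fsum_nneg_subset => //.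
  by move=> t /set_mem At; apply: mem_set; exact: AB.
by move=> t /andP[_ /= /set_mem Bt]; rewrite lee_fin f0.
Qed.

Lemma counting_eq_natP (T : choiceType) (R : realType) (X : set T) (k : nat) :
  counting X = k%:R%:E :> \bar R ->
  finite_set X /\ size (finmap.enum_fset (fset_set X)) = k.
Proof.
rewrite /counting; case: ifPn => [/asboolP fX|//] [/eqP].
by rewrite eqr_nat => /eqP.
Qed.

Lemma counting_set1 (T : choiceType) (R : realType) (x : T) :
  counting [set x] = 1%E :> \bar R.
Proof.
rewrite /counting; case: ifPn => [_|/asboolP[]//].
by rewrite fset_set1 finmap.cardfs1.
Qed.

(** Points of a configuration have distinct locations, and a facet determines
    its center. *)
Lemma placed_facet_inj (R : realType) (g : config R) :
  set_inj (points g) placed_facet.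
Proof.
move=> [x [m r]] [y [n s]] /set_mem gx /set_mem gy e.
have [_ /= [hm]] := config_marks gx; rewrite /= in_itv /= andbT => r0.
have [_ /= [hn]] := config_marks gy; rewrite /= in_itv /= andbT => s0.
apply: (@config_simple _ g); [exact: mem_set|exact: mem_set|].
exact: (placed_facet_center (half_circle_unit hm) (half_circle_unit hn)
  (ltW r0) (ltW s0) e).
Qed.

Lemma finite_restriction (R : realType) (L : set (R * R)) (g : config R) :
  bounded_set L -> finite_set (restriction L g).
Proof.
move=> bL; have inj : set_inj (restriction L g) fst.
  move=> p q /set_mem[gp _] /set_mem[gq _].
  by apply: (@config_simple _ g); exact: mem_set.
rewrite -(eq_finite_set (inj_card_eq inj)).
apply: sub_finite_set (config_locally_finite g bL).
by move=> _ [p [gp [Lp _]] <-]; split => //; exists p.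
Qed.

(** The pairs of [P1 * P2] contribute one intersection point each, and distinct
    pairs of points give distinct pairs of facets; the other terms of the sum are
    nonnegative and only lower the energy, since [a2 <= 0]. *)
Lemma energy_le (R : realType) (a2 : R) (L : set (R * R)) (g : config R)
    (P1 P2 : set (R * R * (R * R * R))) (k l : nat) :
  a2 <= 0 -> bounded_set L ->
  P1 `<=` restriction L g -> P2 `<=` restriction L g ->
  counting P1 = k%:R%:E :> \bar R -> counting P2 = l%:R%:E :> \bar R ->
  (forall p q, P1 p -> P2 q -> p <> q) ->
  (forall p q, P1 p -> P2 q ->
    exists c, placed_facet p `&` placed_facet q = [set c]) ->
  energy a2 (restriction L g) <= a2 * (k * l)%:R.
Proof.
move=> a20 bL P1g P2g /counting_eq_natP[fP1 P1k] /counting_eq_natP[fP2 P2l] P12 cross.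
have injG := placed_facet_inj (g := g).
have Gg p : restriction L g p -> points g p by case.
have fG : finite_set (restriction L g) by exact: finite_restriction.
rewrite /energy ler_wnM2l//.
pose h (p : (R * R * (R * R * R)) * (R * R * (R * R * R))) :=
  (placed_facet p.1, placed_facet p.2).
have injh : set_inj (P1 `*` P2) h.
  move=> [p q] [p' q'] /set_mem[/= /P1g/Gg pg /P2g/Gg qg].
  move=> /set_mem[/= /P1g/Gg pg' /P2g/Gg qg'] [e1 e2].
  by congr pair; apply: injG => //; exact: mem_set.
pose F (K : set (R * R) * set (R * R)) : R := fine (counting (K.1 `&` K.2) : \bar R)
   * ((counting (K.1 `&` K.2) : \bar R) < +oo)%E%:R.
have -> : (k * l)%:R = \sum_(K \in h @` (P1 `*` P2)) F K.
  rewrite fsbig_image//=.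
  rewrite (eq_fsbigr (fun=> 1)); last first.
    move=> [p q] /set_mem[/= pP qP]; rewrite /F /h /=.
    have [c ->] := cross _ _ pP qP.
    by rewrite counting_set1 /= ltry mulr1.
  rewrite -(pair_fsbig _ (fun=> fun=> 1))// (fsbig_finite _ _ fP1)/=.
  rewrite (fsbig_finite _ _ fP2) /= !big_const_seq !count_predT !iter_addr_0.
  by rewrite P1k P2l natrM mulrC mulr_natr.
apply: ler_fsum_subset.
- apply: (@sub_finite_set _ _ (facets (restriction L g) `*` facets (restriction L g))).
    by move=> K [].
  by apply: finite_setX; exact: finite_image.
- move=> _ [[p q] /= [P1p P2q] <-]; split=> /=.
  + by exists p => //; exact: P1g.
  + by exists q => //; exact: P2g.
  move=> pq; apply: (P12 _ _ P1p P2q); apply: injG => //; apply: mem_set.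
  + exact/Gg/P1g.
  + exact/Gg/P2g.
by move=> K _; rewrite mulr_ge0// fine_ge0// /counting; case: ifP.
Qed.

(** * Growth *)

Lemma fact_le_expn (k : nat) : (k`! <= k ^ k)%N.
Proof.
case: k => // k; elim: k => // k IH; rewrite factS [leqRHS]expnS leq_mul2l /=.
by apply: leq_trans IH _; rewrite leq_exp2r.
Qed.

(** Since [k`! <= k ^ k], the right-hand side is at least the [k]-th power of
    [expR (c * k) * m / k ^ 2], and the cubic term of the exponential series
    bounds this base below by a multiple of [k]; once the base is at least 2,
    the power is at least [2 ^ k >= k]. *)
Lemma gaussian_beats_factorial (R : realType) (c m M : R) : 0 < c -> 0 < m ->
  exists k : nat, M <= expR (c * (k * k)%:R) * (m ^+ k / k`!%:R ^+ 2).
Proof.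
move=> c0 m0.
(* 6 is the factorial in the cubic term of expR *)
pose A := c ^+ 3 / 6 * m.
have A0 : 0 < A by rewrite mulr_gt0// divr_gt0// exprn_gt0.
pose k := (maxn (Num.truncn (2 / A)) (Num.truncn M)).+1.
have kA : 2 <= A * k%:R.
  rewrite mulrC -ler_pdivrMr//; apply/ltW/(lt_le_trans (truncnS_gt _)).
  by rewrite ler_nat ltnS leq_maxl.
have kM : M <= k%:R.
  apply/ltW/(lt_le_trans (truncnS_gt _)).
  by rewrite ler_nat ltnS leq_maxr.
have k0 : 0 < k%:R :> R by rewrite ltr0n.
have base : A * k%:R <= expR (c * k%:R) * m / k%:R ^+ 2.
  rewrite ler_pdivlMr ?exprn_gt0//.
  have -> : A * k%:R * k%:R ^+ 2 = (c * k%:R) ^+ 3 / 6 * m by rewrite /A; field.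
  rewrite ler_pM2r//; have := @expR_ge1Dxn R (c * k%:R) 2 (mulr_ge0 (ltW c0) (ltW k0)).
  by apply: le_trans; rewrite lerDr.
exists k; apply: (le_trans kM).
apply: (@le_trans _ _ ((expR (c * k%:R) * m / k%:R ^+ 2) ^+ k)).
  apply: (@le_trans _ _ (2 ^+ k)).
    by rewrite -natrX ler_nat ltnW// ltn_expl.
  have base2 := le_trans kA base.
  by apply: lerXn2r; rewrite ?nnegrE//; apply: le_trans base2.
have -> : expR (c * (k * k)%:R) = expR (c * k%:R) ^+ k.
  by rewrite -expRM_natr natrM mulrA.
rewrite -[(_ * m) / _]mulrA !exprMn exprVn.
rewrite ler_wpM2l ?exprn_ge0 ?expR_ge0// ler_wpM2l ?exprn_ge0 ?(ltW m0)//.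
rewrite lef_pV2 ?posrE ?exprn_gt0 ?ltr0n ?fact_gt0//.
rewrite -exprM mulnC exprM; apply: lerXn2r; rewrite ?nnegrE ?exprn_ge0//.
by rewrite -natrX ler_nat fact_le_expn.
Qed.

(** * Counts of the Poisson process *)

Lemma measurable_npoints_eq (R : realType) (B : set (R * R * (R * R * R)))
    (r : \bar R) : measurable B ->
  measurable ([set g | npoints B g = r] : set (config_space R)).
Proof.
move=> mB; apply: sub_sigma_algebra; by exists B, [set r]; split.
Qed.

Lemma poisson_probE (R : realType) (rate : R) (k : nat) : 0 < rate ->
  poisson_prob rate 0%N [set k] = (rate ^+ k / k`!%:R * expR (- rate))%:E.
Proof.
by move=> r0; rewrite /poisson_prob r0 esum_set1 /poisson_pmf r0// lee_fin
  mulr_ge0 ?expR_ge0 ?divr_ge0 ?exprn_ge0// ltW.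
Qed.

Lemma poisson_two_counts (R : realType) (mu : set (R * R * (R * R * R)) -> \bar R)
    (P : probability (config_space R) R) (B1 B2 : set (R * R * (R * R * R)))
    (k l : nat) :
  poisson_process_law mu P -> measurable B1 -> measurable B2 ->
  B1 `&` B2 = set0 -> (mu B1 < +oo)%E -> (mu B2 < +oo)%E ->
  P ([set g | npoints B1 g = k%:R%:E] `&` [set g | npoints B2 g = l%:R%:E]) =
  (poisson_prob (fine (mu B1)) 0%N [set k] *
   poisson_prob (fine (mu B2)) 0%N [set l])%E.
Proof.
move=> [law _ indep] mB1 mB2 B12 fB1 fB2.
pose B (i : 'I_2) := if i == ord0 then B1 else B2.
pose C (i : 'I_2) : set (\bar R) := if i == ord0 then [set k%:R%:E] else [set l%:R%:E].
have mB i : measurable (B i) by rewrite /B; case: ifP.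
have tB : trivIset setT B.
  apply/trivIsetP => i j _ _; rewrite /B.
  by case: (unliftP ord0 i) => [a ->|->]; case: (unliftP ord0 j) => [b ->|->];
    rewrite ?ord1 ?eqxx//= => _; rewrite setIC.
have mC i : measurable (C i).
  by rewrite /C; case: ifP => _; exact: emeasurable_set1.
have := indep _ B mB tB C mC.
rewrite big_ord_recl big_ord1 /B /C /= -!law//= => <-; congr (P _).
apply/seteqP; split => g.
  by move=> [g1 g2] i _ /=; case: ifP.
move=> h; split; first exact: (h ord0).
by have := h (lift ord0 ord0) I.
Qed.

Lemma lebesgue2_bounded (R : realType) (L : set (R * R)) :
  measurable L -> bounded_set L -> (lebesgue2 L < +oo)%E.
Proof.
move=> mL [N [_ LN]]; pose M := N + 1.
have {LN}LM : forall x, L x -> `|x| <= M by apply: LN; rewrite ltrDl.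
pose I : set R := [set` `[- M, M]].
have mI : measurable (I : set R) by exact: measurable_itv.
have mII : measurable (I `*` I : set (R * R)) by exact: measurableX.
apply: (@le_lt_trans _ _ (lebesgue2 (I `*` I))).
  apply: le_measure; [exact: mem_set|exact: mem_set|].
  move=> [x y] /LM /=; rewrite /I/= !in_itv /= -!ler_norml.
  by rewrite prod_normE ge_max => /andP.
have fI : (lebesgue_measure (I : set R) < +oo)%E.
  by rewrite /I lebesgue_measure_itv; case: ifP => _; rewrite ltry.
by rewrite /lebesgue2 product_measure1E// lte_mul_pinfty// ge0_fin_numE.
Qed.

Lemma intensity_prod (R : realType) (z : R) (L : set (R * R))
    (mL : measurable L) (Q : probability (R * R * R)%type R)
    (D : set (R * R)) (A : set (R * R * R)) :
  measurable D -> D `<=` L -> measurable A ->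
  intensity z mL Q (D `*` A) = (z%:E * (lebesgue2 D * Q A))%E.
Proof.
move=> mD DL mA; rewrite /intensity product_measure1E//.
by rewrite /= /mrestr (setIidl DL).
Qed.

Lemma intensity_prod_pos (R : realType) (z : R) (L : set (R * R))
    (mL : measurable L) (Q : probability (R * R * R)%type R)
    (D : set (R * R)) (A : set (R * R * R)) :
  0 < z -> bounded_set L -> measurable D -> D `<=` L -> measurable A ->
  (0 < lebesgue2 D)%E -> (0 < Q A)%E ->
  (0 < intensity z mL Q (D `*` A) < +oo)%E.
Proof.
move=> z0 bL mD DL mA D0 A0; rewrite intensity_prod// !mule_gt0//=.
have fD : (lebesgue2 D < +oo)%E.
  apply: le_lt_trans (lebesgue2_bounded mL bL).
  by apply: le_measure; [exact: mem_set|exact: mem_set|].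
have fA : (Q A < +oo)%E by rewrite (le_lt_trans (probability_le1 _ _))// ltry.
apply: lte_mul_pinfty; rewrite ?lee_fin ?ltW//.
by rewrite lte_mul_pinfty// ge0_fin_numE.
Qed.

(** * Divergence of the partition function *)

Theorem theorem4p6 (R : realType) (a2 z : R)
    (Q : probability (R * R * R)%type R)
    (ha2 : a2 < 0) (hz : 0 < z)
    (hQ : Q (half_circle `*` `]0, +oo[) = 1%E)
    (hdirs : exists (u v : R * R) (a b eps : R),
      [/\ half_circle u, half_circle v, 0 < a <= b & 0 < eps] /\
      [/\ (0 < Q (circle_nbhd u eps `*` `]a, b[))%E,
          (0 < Q (circle_nbhd v eps `*` `]a, b[))%E
        & circle_nbhd u eps `&` circle_nbhd v eps = set0])
    (L : set (R * R)) (mL : measurable L) (bL : bounded_set L)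
    (L_gt0 : (0 < lebesgue2 L)%E)
    (P : probability (config_space R) R)
    (hP : poisson_process_law (intensity z mL Q) P) :
  partition_function a2 L P = +oo%E /\
  ~ exists G : probability (config_space R) R, is_gibbs_measure a2 L P G.
Proof.
suff Zoo : partition_function a2 L P = +oo%E.
  by split => // -[G [+ _]]; rewrite Zoo ltxx andbF.
have [u [v [a [b [eps [[hu hv /andP[a0 _] e0] [Qu Qv uv]]]]]]] := hdirs.
have [A1 [A2 [rho [[mA1 mA2 A1_gt0 A2_gt0] [rho0 A12 cross]]]]] :=
  crossing_classes hu hv a0 e0 Qu Qv uv.
(* all centers in D are close enough for facets of the two classes to cross *)
have [D [mD DL D_gt0 Drho]] := small_positive_piece mL L_gt0 rho0.
pose B1 := D `*` A1; pose B2 := D `*` A2.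
have mB1 : measurable B1 by exact: measurableX.
have mB2 : measurable B2 by exact: measurableX.
have B12 : B1 `&` B2 = set0.
  apply/seteqP; split => // p [[_ p1] [_ p2]].
  by have : (A1 `&` A2) p.2 by []; rewrite A12.
have /andP[l1 f1] : (0 < intensity z mL Q B1 < +oo)%E by exact: intensity_prod_pos.
have /andP[l2 f2] : (0 < intensity z mL Q B2 < +oo)%E by exact: intensity_prod_pos.
set lam1 := fine (intensity z mL Q B1); set lam2 := fine (intensity z mL Q B2).
have lam1_gt0 : 0 < lam1 by rewrite fine_gt0// l1 f1.
have lam2_gt0 : 0 < lam2 by rewrite fine_gt0// l2 f2.
apply/eqyP => M M0.
(* w ^-1 times the probability of the event E below is (lam1 lam2) ^ k / k! ^ 2 *)
pose w := expR (- lam1) * expR (- lam2).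
have w0 : 0 < w by rewrite mulr_gt0// expR_gt0.
have a2_gt0 : 0 < - a2 by rewrite oppr_gt0.
have [k Mk] := gaussian_beats_factorial (M / w) a2_gt0 (mulr_gt0 lam1_gt0 lam2_gt0).
pose E := [set g | npoints B1 g = k%:R%:E] `&` [set g | npoints B2 g = k%:R%:E].
have mE : measurable (E : set (config_space R)).
  by apply: measurableI; exact: measurable_npoints_eq.
have weight_ge g : E g -> ((expR (- a2 * (k * k)%:R))%:E <= gibbs_weight a2 L g)%E.
  move=> [g1 g2]; rewrite /gibbs_weight lee_fin ler_expR mulNr lerN2.
  apply: (energy_le (ltW ha2) bL _ _ g1 g2).
  - by move=> p [gp [Dp _]]; split => //; split => //; exact: DL.
  - by move=> p [gp [Dp _]]; split => //; split => //; exact: DL.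
  - move=> p q [_ B1p] [_ B2q] pq; have : (B1 `&` B2) p by rewrite pq in B1p *.
    by rewrite B12.
  move=> [x m1] [y m2] [_ [Dx A1m]] [_ [Dy A2m]].
  by apply: cross => //; exact: Drho.
have PE : P E = (lam1 ^+ k / k`!%:R * expR (- lam1) *
                (lam2 ^+ k / k`!%:R * expR (- lam2)))%:E.
  by rewrite (poisson_two_counts _ _ hP) // !poisson_probE.
have weight_ge0 g : (0 <= gibbs_weight a2 L g)%E by rewrite lee_fin expR_ge0.
have Z_ge : ((expR (- a2 * (k * k)%:R))%:E * P E <= partition_function a2 L P)%E.
  exact: (cst_le_integral P mE (expR_ge0 _) weight_ge0 weight_ge).
apply: le_trans Z_ge; rewrite PE -EFinM lee_fin.
move: Mk; rewrite ler_pdivrMr// => /le_trans; apply.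
by rewrite le_eqVlt; apply/orP; left; apply/eqP; rewrite /w exprMn; field.
Qed.
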